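(* For positive integers $k_1,\dots,k_l$ with $k_1\ge2$, \[ \begin{aligned} &\sum_{i=1}^l\sum_{j=0}^{k_i-2}\zeta_q^t(k_1,\dots,k_{i-1},k_i-j,j+1,k_{i+1},\dots,k_l)\\ &=\sum_{i=1}^l\{1+(k_i-2+\delta_{i,l})t\}\,\zeta_q^t(k_1,\dots,k_{i-1},k_i+1,k_{i+1},\dots,k_l) +t(t-1)\sum_{i=1}^{l-1}\zeta_q^t(k_1,\dots,k_{i-1},k_i+k_{i+1}+1,k_{i+2},\dots,k_l)\\ &\quad+(1-q)\Bigl\{\sum_{i=1}^l t(k_i-1)\,\zeta_q^t(k_1,\dots,k_l)+t(t-1)\sum_{i=1}^{l-1}\zeta_q^t(k_1,\dots,k_{i-1},k_i+k_{i+1},k_{i+2},\dots,k_l)\Bigr\}, \end{aligned} \] where $\delta_{i,l}$ is the Kronecker delta.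
   Context: Let $q$, $t$ be formal parameters and $[n]=\frac{1-q^n}{1-q}$. For positive integers $k_1,\dots,k_l$ with $k_1\ge 2$ put $\zeta_q(k_1,\dots,k_l)=\sum_{m_1>m_2>\cdots>m_l\ge1}\prod_{a=1}^l \frac{q^{(k_a-1)m_a}}{[m_a]^{k_a}}\in\mathbb{Q}[[q]]$. The weight of an index is the sum of its entries and its depth is the number of entries. Define $\zeta_q^t(k_1,\dots,k_l)=\sum'_{\mathbf p}(1-q)^{k-\mathrm{wt}(\mathbf p)}\zeta_q(\mathbf p)\,t^{l-\mathrm{dep}(\mathbf p)}\in\mathbb{Q}[[q]][t]$, where $k=k_1+\cdots+k_l$ and $\mathbf p$ runs over all indices of the form $(k_1\ \square\ k_2\ \square\cdots\square\ k_l)$ with each $\square$ filled by '','' (comma), ''$+$'' or ''$-1+$''. An inner sum $\sum_{j=0}^{k_i-2}$ is empty when $k_i=1$. *)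

(* Defs.v *)
(* Formal power series over a ring R are coefficient
   functions nat -> R, with Cauchy product.  Q[[q]][t] is realised inside
   Q[t][[q]] = fps {poly rat}, with t = 'X (the embedding is injective). *)
From HB Require Import structures.
From mathcomp Require Import all_boot all_order all_algebra.
Set Implicit Arguments. Unset Strict Implicit. Unset Printing Implicit Defensive.
Import Order.TTheory GRing.Theory Num.Theory.
Local Open Scope ring_scope.

Definition fps (R : Type) := nat -> R.

Section FPS.
Variable R : comRingType.
Definition fps1 : fps R := fun n => (n == 0%N)%:R.
Definition fpsX : fps R := fun n => (n == 1%N)%:R.
Definition fps_add (f g : fps R) : fps R := fun n => f n + g n.
Definition fps_opp (f : fps R) : fps R := fun n => - f n.
Definition fps_scale (c : R) (f : fps R) : fps R := fun n => c * f n.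
Definition fps_mul (f g : fps R) : fps R :=
  fun n => \sum_(i < n.+1) f i * g (n - i)%N.
Definition fps_pow (f : fps R) (k : nat) : fps R := iter k (fps_mul f) fps1.
(* inverse of a series with constant term 1:  1/f = sum_j (1 - f)^j,
   whose n-th coefficient only involves j <= n *)
Definition fps_inv (f : fps R) : fps R :=
  fun n => \sum_(j < n.+1) fps_pow (fps_add fps1 (fps_opp f)) j n.
Definition qint (m : nat) : fps R := fun n => (n < m)%N%:R.
Definition one_minus_q : fps R := fps_add fps1 (fps_opp fpsX).

Definition zterm (k m : nat) : fps R :=
  fps_mul (fps_pow fpsX ((k - 1) * m)) (fps_pow (fps_inv (qint m)) k).

Fixpoint zsum (ks : seq nat) (M : nat) : fps R :=
  match ks with
  | [::] => fps1
  | k :: ks' => fun n => \sum_(1 <= m < M) fps_mul (zterm k m) (zsum ks' m) n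
  end.

(* zeta_q(ks): the q-adically convergent sum.  For k_1 >= 2 every term with
   m_1 > n has q-adic order >= (k_1 - 1) m_1 > n, so the n-th coefficient of
   the full sum is the n-th coefficient of the partial sum over m_1 <= n. *)
Definition zeta_q (ks : seq nat) : fps R := fun n => zsum ks n.+1 n.
End FPS.

(* Filling the boxes: op 0 = ",", op 1 = "+", op 2 = "-1+". *)
Fixpoint build (cur : nat) (ks : seq nat) (ops : seq nat) : seq nat :=
  match ks, ops with
  | k :: ks', o :: ops' =>
      if o == 0%N then cur :: build k ks' ops'
      else if o == 1%N then build (cur + k) ks' ops'
      else build (cur + k - 1) ks' ops'
  | _, _ => [:: cur]
  end.

Fixpoint allops (n : nat) : seq (seq nat) :=
  match n with
  | 0 => [:: [::]]
  | n'.+1 => flatten [seq [seq o :: s | s <- allops n'] | o <- iota 0 3]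
  end.

Definition zeta_qt (ks : seq nat) : fps {poly rat} :=
  match ks with
  | [::] => fps1 _
  | k :: ks' => fun n =>
      \sum_(o <- allops (size ks'))
        let p := build k ks' o in
        fps_scale ('X ^+ (size ks - size p))
          (fps_mul (fps_pow (one_minus_q _) (sumn ks - sumn p)) (zeta_q _ p)) n
  end.

(* Main.v *)
(* Put x_m = q^m/[m], y_m = 1/[m] and z_k(m) = x_m^(k-1) y_m.  Since
   y_m = x_m + (1-q), one has z_k z_k' = z_(k+k') + (1-q) z_(k+k'-1), so the
   three fillings of a box turn zeta_q^t into the sum over m_1 >= ... >= m_l of
   prod_a z_(k_a)(m_a), weighted by t to the number of equalities.  For n < m
   the entry (k-j, j+1) is summed over j by partial fractions:
     sum_(j < k-1) z_(k-j)(m) z_(j+1)(n)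
       = z_k(n) (x_(m-n) - x_m) - z_k(m) x_(m-n),
   and the partial sums of x telescope along the chain m_1 >= ... >= m_l.
   Truncated at m_1 < M, the identity is exact up to a boundary term, which is
   divisible by q^M because k_1 >= 2. *)
From HB Require Import structures.
Require Import Defs.
From mathcomp Require Import all_boot all_order all_algebra ring zify boolp.
Import GRing.Theory.
Local Open Scope ring_scope.

(** * Interpolated sums over a commutative ring *)

Section WeightedSums.
Variable R : comNzRingType.
Implicit Types (c : R) (f g G : nat -> R).

Lemma sum_triangle (F : nat -> nat -> R) a :
  \sum_(1 <= m < a) \sum_(1 <= n < m) F m n
  = \sum_(1 <= n < a) \sum_(n.+1 <= m < a) F m n.
Proof.
elim: a => [|[|a] IHa]; first by rewrite !big_geq.
  by rewrite !big_geq.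
rewrite big_nat_recr //= IHa [RHS]big_nat_recr //= [X in _ = _ + X]big_geq //.
rewrite addr0 -big_split /=; apply: eq_big_nat => n /andP[_ lt_na].
by rewrite [RHS]big_nat_recr.
Qed.

(* [c] is the weight of the top index [m = a]: [t] inside a chain, [0] for a
   strict upper bound. *)
Definition wsum c G a : R := \sum_(1 <= m < a) G m + c * G a.

Lemma eq_wsum {c f g a} : (0 < a)%N ->
  (forall m, (0 < m)%N -> f m = g m) -> wsum c f a = wsum c g a.
Proof.
move=> a_gt0 eq_fg; rewrite /wsum eq_fg //; congr (_ + _).
by apply: eq_big_nat => m /andP[m_gt0 _]; apply: eq_fg.
Qed.

Lemma wsumD c f g a : wsum c f a + wsum c g a = wsum c (fun m => f m + g m) a.
Proof. by rewrite /wsum big_split /= mulrDr addrACA. Qed.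

Lemma wsumZ c b f a : b * wsum c f a = wsum c (fun m => b * f m) a.
Proof. by rewrite /wsum mulrDr mulr_sumr mulrCA. Qed.

Lemma wsum_sum c n (F : nat -> nat -> R) a :
  \sum_(i < n) wsum c (F i) a = wsum c (fun m => \sum_(i < n) F i m) a.
Proof. by rewrite /wsum big_split /= mulr_sumr exchange_big. Qed.

Lemma wsum_mulsum c n f (F : nat -> nat -> R) a :
  \sum_(i < n) wsum c (fun m => f m * F i m) a
  = wsum c (fun m => f m * \sum_(i < n) F i m) a.
Proof.
rewrite (wsum_sum c n (fun i m => f m * F i m)) /wsum.
congr (_ + c * _); last by rewrite mulr_sumr.
by apply: eq_bigr => m _; rewrite mulr_sumr.
Qed.

Lemma wsum_mulZ c b f g a :
  b * wsum c (fun m => f m * g m) a = wsum c (fun m => f m * (b * g m)) a.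
Proof.
rewrite wsumZ /wsum; congr (_ + c * _); last by rewrite mulrCA.
by apply: eq_bigr => m _; rewrite mulrCA.
Qed.

Lemma wsum_triangle c (F : nat -> nat -> R) a :
  wsum c (fun m => \sum_(1 <= n < m) F m n) a =
  \sum_(1 <= n < a) (\sum_(n.+1 <= m < a) F m n + c * F a n).
Proof. by rewrite /wsum sum_triangle mulr_sumr big_split. Qed.

End WeightedSums.

Section InterpolatedSums.
Variables (R : comNzRingType) (h t : R) (x y : nat -> R).

Definition zfactor k m : R := x m ^+ k.-1 * y m.

(** Sums over chains [a] $\ge m_1\ge\dots\ge m_l\ge1$ with one factor [t] per equality
    $m_i=m_{i+1}$. The weight [c] of $m_1$ = [a] is kept apart: it is [0] at the outer bound of the
    theorem and [t] at every inner one. *)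
Fixpoint tsum c ks : nat -> R :=
  match ks with
  | [::] => fun => 1
  | k :: ks' => wsum R c (fun m => zfactor k m * tsum t ks' m)
  end.

(** * Telescoping of the partial sums of [x] *)

Definition harm a : R := \sum_(1 <= s < a) x s.

Lemma harmS a : (0 < a)%N -> harm a.+1 = harm a + x a.
Proof. by move=> a_gt0; rewrite /harm big_nat_recr. Qed.

Lemma harm_shift n d : \sum_(n.+1 <= m < n + d) x (m - n) = harm d.
Proof.
rewrite -[n.+1]add1n big_addn addKn.
by apply: eq_big_nat => m _; rewrite addnK.
Qed.

Lemma harm_rev n a : (n < a)%N -> \sum_(n.+1 <= m < a) x (a - m) = harm (a - n).
Proof.
move=> lt_na; rewrite -(harm_shift n) subnKC 1?ltnW // big_nat_rev /=.
by apply: eq_big_nat => m /andP[lt_nm lt_ma]; congr x; lia.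
Qed.

(* The part of the telescoping sum left at the upper end [a] of the chain. *)
Definition boundary c G a : R :=
  \sum_(1 <= m < a) G m * (harm (a - m) + c * x (a - m) - harm a - c * x a)
  - c * (G a * harm a.+1).

(** For fixed [n], the terms [x (m - n)] add up to [harm (a - n)] and the terms [x m] to
    [harm a - harm n.+1]. What depends on [a] goes into [boundary]; [harm n.+1] stays inside the
    chain. *)
Lemma wsum_boundary c G a : (0 < a)%N ->
  \sum_(1 <= n < a) G n *
     (\sum_(n.+1 <= m < a) (x (m - n) - x m) + c * (x (a - n) - x a))
  = boundary c G a + wsum R c (fun m => G m * harm m.+1) a.
Proof.
move=> a_gt0; rewrite /boundary /wsum addrACA addNr addr0.
rewrite -big_split /=; apply: eq_big_nat => n /andP[n_gt0 lt_na].
rewrite sumrB -{1}(subnKC (ltnW lt_na)) harm_shift.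
have -> : harm a = harm n.+1 + \sum_(n.+1 <= m < a) x m.
  by rewrite /harm -big_cat_nat.
ring.
Qed.

(** In the convolution [G r] has the factor [harm (m - r) + t * x (m - r)], which [boundary]
    contains as well and cancels. There survives [harm m.+1 - harm m - t * x m], that is
    [(1 - t) * x m]. *)
Lemma boundary_harm (G : nat -> R) m : (0 < m)%N ->
  harm m.+1 * wsum R t G m - \sum_(1 <= n < m) x (m - n) * wsum R t G n
  + boundary t G m = (1 - t) * x m * \sum_(1 <= r < m) G r.
Proof.
move=> m_gt0.
have -> : \sum_(1 <= n < m) x (m - n) * wsum R t G n =
   \sum_(1 <= r < m) G r * (harm (m - r) + t * x (m - r)).
  under eq_bigr => n _ do rewrite /wsum mulrDr mulr_sumr.
  rewrite big_split /= sum_triangle -big_split /=.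
  apply: eq_big_nat => r /andP[r_gt0 lt_rm].
  rewrite -mulr_suml.
  by rewrite harm_rev //; ring.
transitivity (\sum_(1 <= r < m)
   (harm m.+1 * G r - G r * (harm (m - r) + t * x (m - r))
    + G r * (harm (m - r) + t * x (m - r) - harm m - t * x m))).
  by rewrite big_split sumrB /= -mulr_sumr /wsum /boundary; ring.
rewrite mulr_sumr harmS //; apply: eq_bigr => r _; ring.
Qed.

(** These two relations are all that the truncated identity uses of $x_m=q^m/[m]$ and $y_m=1/[m]$;
    [h] stands for $1-q$. *)
Hypothesis y_x : forall m, (0 < m)%N -> y m = x m + h.
Hypothesis y_mul_x : forall m n, (0 < n < m)%N ->
  y m * x (m - n) = y n * (x (m - n) - x m).

(** Induction on [k]: a step multiplies the earlier terms by [x m] and adds one last term, where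
    [y n * x m = x (m - n) * (x n - x m)] makes the result telescope. *)
Lemma partial_fractions k m n : (0 < k)%N -> (0 < n < m)%N ->
  \sum_(j < k.-1) zfactor (k - j) m * zfactor j.+1 n
  = zfactor k n * (x (m - n) - x m) - zfactor k m * x (m - n).
Proof.
case: k => // k _ /[dup] /y_mul_x yx /andP[n_gt0 lt_nm]; rewrite /zfactor /=.
have m_gt0 : (0 < m)%N by apply: ltn_trans lt_nm.
have yxx : y n * x m = x (m - n) * (x n - x m).
  have -> : x n - x m = y n - y m by rewrite !y_x //; ring.
  by rewrite mulrBr [_ * y m]mulrC yx; ring.
elim: k => [|k IHk].
  by rewrite big_ord0 !expr0 !mul1r yx subrr.
rewrite big_ord_recr /=.
have -> : \sum_(i < k) x m ^+ (k.+2 - i).-1 * y m * (x n ^+ i * y n)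
   = x m * \sum_(i < k) x m ^+ (k.+1 - i).-1 * y m * (x n ^+ i * y n).
  rewrite mulr_sumr; apply: eq_bigr => i _.
  have -> : (k.+2 - i).-1 = (k.+1 - i).-1.+1 by have := ltn_ord i; lia.
  by rewrite exprS; ring.
rewrite IHk (_ : (k.+2 - k).-1 = 1%N); last by lia.
rewrite expr1 !exprS.
have -> : x m * y m * (x n ^+ k * y n) = x n ^+ k * y m * (y n * x m) by ring.
rewrite yxx.
have -> : x n ^+ k * y m * (x (m - n) * (x n - x m))
   = x n ^+ k * (y m * x (m - n)) * (x n - x m) by ring.
rewrite yx; ring.
Qed.

(** For [n < m] partial fractions apply, and exchanging the summations turns the part with
    [x (m - n) - x m] into boundary and harmonic terms. For [n = m] all [k - 1] products of factors
    equal [x m ^+ k.-1 * y m ^+ 2], that is [zfactor k.+1 m + h * zfactor k m]. *)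
Lemma split_entry c k g a : (0 < k)%N -> (0 < a)%N ->
  \sum_(j < k.-1) wsum R c
     (fun m => zfactor (k - j) m * wsum R t (fun n => zfactor j.+1 n * g n) m) a
  = boundary c (fun m => zfactor k m * g m) a
    + wsum R c (fun m => zfactor k m *
        (harm m.+1 * g m - \sum_(1 <= n < m) x (m - n) * g n)) a
    + t * (k%:R - 1) *
      wsum R c (fun m => (zfactor k.+1 m + h * zfactor k m) * g m) a.
Proof.
move=> k_gt0 a_gt0.
rewrite (wsum_sum R c k.-1 (fun j m =>
  zfactor (k - j) m * wsum R t (fun n => zfactor j.+1 n * g n) m)) wsumZ.
pose F m n := zfactor k n * g n * (x (m - n) - x m).
(* Once the boundary is also a [wsum], the two sides can be compared for each [m] separately. *)
have -> : boundary c (fun m => zfactor k m * g m) a =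
  wsum R c (fun m => \sum_(1 <= n < m) F m n
                     - zfactor k m * g m * harm m.+1) a.
  apply: (addIr (wsum R c (fun m => zfactor k m * g m * harm m.+1) a)).
  rewrite -(wsum_boundary c (fun m => zfactor k m * g m)) // wsumD.
  rewrite (@eq_wsum _ c (fun m => _ - _ + _) (fun m => \sum_(1 <= n < m) F m n)) //.
    rewrite wsum_triangle; apply: eq_bigr => n _.
    by rewrite /F mulrDr mulr_sumr mulrCA.
  by move=> m _; rewrite subrK.
rewrite !wsumD; apply: eq_wsum => // m m_gt0.
under eq_bigr => j _ do rewrite /wsum mulrDr mulr_sumr.
rewrite big_split /= exchange_big /=.
have -> : \sum_(i < k.-1) zfactor (k - i) m * (t * (zfactor i.+1 m * g m))
   = t * (k%:R - 1) * ((zfactor k.+1 m + h * zfactor k m) * g m).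
  transitivity (\sum_(i < k.-1) t * ((zfactor k.+1 m + h * zfactor k m) * g m)).
    apply: eq_bigr => i _; rewrite /zfactor [(k.+1).-1]/= [(i.+1).-1]/=.
    have lt_ik := ltn_ord i.
    have -> : x m ^+ k = x m ^+ k.-1 * x m by rewrite -exprSr prednK.
    have -> : x m ^+ k.-1 = x m ^+ (k - i).-1 * x m ^+ i.
      by rewrite -exprD; congr (_ ^+ _); lia.
    rewrite {2}y_x //; rewrite y_x //; ring.
  rewrite sumr_const card_ord -[LHS]mulr_natr [k%:R - 1](_ : _ = k.-1%:R); first by ring.
  by rewrite -{1}(prednK k_gt0) -natr1 addrK.
congr (_ + _).
have -> : \sum_(1 <= n < m) F m n - zfactor k m * g m * harm m.+1
   + zfactor k m * (harm m.+1 * g m - \sum_(1 <= n < m) x (m - n) * g n)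
  = \sum_(1 <= n < m) (F m n - zfactor k m * (x (m - n) * g n)).
  by rewrite sumrB -mulr_sumr; ring.
apply: eq_big_nat => n n_lt.
under eq_bigr => j _ do rewrite mulrA.
by rewrite -mulr_suml partial_fractions // /F; ring.
Qed.

(** * The truncated identity, by recursion on the index *)

Definition split_sum c ks a : R :=
  \sum_(i < size ks) \sum_(j < (nth 0%N ks i).-1)
    tsum c (take i ks ++ [:: (nth 0 ks i - j)%N; j.+1] ++ drop i.+1 ks) a.

Definition raise_sum c ks a : R :=
  \sum_(i < size ks)
    (1 + ((nth 0%N ks i)%:R - 2 + (i == (size ks).-1 :> nat)%:R) * t)
      * tsum c (take i ks ++ (nth 0%N ks i).+1 :: drop i.+1 ks) a.

(** [d = 1] gives the merges standing alone, [d = 0] those multiplied by $1-q$. *)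
Definition merge_sum d c ks a : R :=
  \sum_(i < (size ks).-1)
    tsum c (take i ks ++ (d + (nth 0 ks i + nth 0 ks i.+1))%N :: drop i.+2 ks) a.

Definition hoffman_rhs c ks a : R :=
  raise_sum c ks a + t * (t - 1) * merge_sum 1 c ks a
  + h * ((\sum_(i < size ks) t * ((nth 0%N ks i)%:R - 1)) * tsum c ks a
         + t * (t - 1) * merge_sum 0 c ks a).

Lemma split_sum_cons c k ks a :
  split_sum c (k :: ks) a = \sum_(j < k.-1) tsum c ((k - j)%N :: j.+1 :: ks) a
    + wsum R c (fun m => zfactor k m * split_sum t ks m) a.
Proof.
rewrite /split_sum big_ord_recl /= drop0; congr (_ + _).
rewrite -(wsum_mulsum R c _ _ (fun i m => \sum_(j < (nth 0%N ks i).-1) tsum t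
  (take i ks ++ [:: (nth 0 ks i - j)%N; j.+1] ++ drop i.+1 ks) m)).
apply: eq_bigr => i _.
by rewrite (wsum_mulsum R c _ _ (fun j m => tsum t
  (take i ks ++ [:: (nth 0 ks i - j)%N; j.+1] ++ drop i.+1 ks) m)).
Qed.

Lemma merge_sum_cons d c k k' ks a :
  merge_sum d c [:: k, k' & ks] a = tsum c ((d + (k + k'))%N :: ks) a
    + wsum R c (fun m => zfactor k m * merge_sum d t (k' :: ks) m) a.
Proof.
rewrite /merge_sum big_ord_recl /= drop0; congr (_ + _).
by rewrite (wsum_mulsum R c _ _ (fun i m => tsum t
  (take i (k' :: ks) ++
   (d + (nth 0 (k' :: ks) i + nth 0 ks i))%N :: drop i.+1 ks) m)).
Qed.

Lemma raise_sum_cons c k k' ks a :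
  raise_sum c [:: k, k' & ks] a
  = (1 + (k%:R - 2) * t) * tsum c [:: k.+1, k' & ks] a
    + wsum R c (fun m => zfactor k m * raise_sum t (k' :: ks) m) a.
Proof.
rewrite {1}/raise_sum [size _]/= big_ord_recl /= addr0; congr (_ + _).
rewrite -(wsum_mulsum R c _ _ (fun i m =>
  (1 + ((nth 0%N (k' :: ks) i)%:R - 2 + (i == size ks :> nat)%:R) * t)
  * tsum t (take i (k' :: ks) ++ (nth 0%N (k' :: ks) i).+1 :: drop i ks) m)).
by apply: eq_bigr => i _; rewrite -wsum_mulZ.
Qed.

(** By [y m = x m + h], the merges with [d = 1] and [d = 0] combine into [x m] times the product of
    the two factors at the same point [m]. *)
Lemma wsum_merge c k k' g a : (0 < k)%N -> (0 < k')%N -> (0 < a)%N ->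
  wsum R c (fun m => zfactor (k + k').+1 m * g m) a
  + h * wsum R c (fun m => zfactor (k + k') m * g m) a
  = wsum R c (fun m => zfactor k m * (x m * zfactor k' m * g m)) a.
Proof.
move=> k_gt0 k'_gt0 a_gt0; rewrite wsumZ wsumD; apply: eq_wsum => // m m_gt0.
case: k k' k_gt0 k'_gt0 => [|k] [|k'] // _ _; rewrite /zfactor addSn addnS /=.
rewrite !exprS exprD y_x //; ring.
Qed.

Lemma wsum_raise_lower c k g a : (0 < a)%N ->
  wsum R c (fun m => (zfactor k.+1 m + h * zfactor k m) * g m) a
  = wsum R c (fun m => zfactor k.+1 m * g m) a
    + h * wsum R c (fun m => zfactor k m * g m) a.
Proof.
by move=> a_gt0; rewrite wsumZ wsumD; apply: eq_wsum => // m _; ring.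
Qed.

Lemma hoffman_rhs_cons c k k' ks a : (0 < k)%N -> (0 < k')%N -> (0 < a)%N ->
  hoffman_rhs c [:: k, k' & ks] a
  = (1 + (k%:R - 2) * t) * tsum c [:: k.+1, k' & ks] a
    + h * (t * (k%:R - 1) * tsum c [:: k, k' & ks] a)
    + t * (t - 1) *
      wsum R c (fun m => zfactor k m * (x m * zfactor k' m * tsum t ks m)) a
    + wsum R c (fun m => zfactor k m * hoffman_rhs t (k' :: ks) m) a.
Proof.
move=> k_gt0 k'_gt0 a_gt0.
rewrite /hoffman_rhs raise_sum_cons !merge_sum_cons -wsum_merge //.
rewrite [size _]/= big_ord_recl /=.
set C := \sum_(i < _) _.
set tc := tsum t (k' :: ks).
have -> : wsum R c (fun m => zfactor k m * (raise_sum t (k' :: ks) m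
   + t * (t - 1) * merge_sum 1 t (k' :: ks) m
   + h * (C * tc m + t * (t - 1) * merge_sum 0 t (k' :: ks) m))) a
 = wsum R c (fun m => zfactor k m * raise_sum t (k' :: ks) m) a
   + t * (t - 1) * wsum R c (fun m => zfactor k m * merge_sum 1 t (k' :: ks) m) a
   + h * (C * wsum R c (fun m => zfactor k m * tc m) a
     + t * (t - 1) * wsum R c (fun m => zfactor k m * merge_sum 0 t (k' :: ks) m) a).
  by rewrite !wsumZ !wsumD wsumZ wsumD; apply: eq_wsum => // m _; ring.
ring.
Qed.

(** Induction on the index, for all [c] and [a], since the tail is a chain below [m] with top weight
    [t]. The boundary of the tail cancels against the convolution left by splitting the head, so
    only the boundary of the head remains. *)
Lemma split_sumE c ks a : (0 < a)%N -> all (leq 1) ks -> ks != [::] ->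
  split_sum c ks a = hoffman_rhs c ks a
    + boundary c (fun m => zfactor (head 0 ks) m * tsum t (behead ks) m) a.
Proof.
move=> a_gt0; case: ks => // k ks /= + _.
elim: ks k c a a_gt0 => [|k' ks IHks] k c a a_gt0 /andP[k_gt0].
  move=> _; rewrite split_sum_cons /= (split_entry c k (fun => 1)) //.
  rewrite /hoffman_rhs /raise_sum /merge_sum !big_ord1 !big_ord0 /=.
  rewrite wsum_raise_lower //.
  have -> : wsum R c (fun m => zfactor k m * split_sum t [::] m) a = 0.
    by rewrite /wsum /split_sum !big_ord0 !mulr0 big1 ?addr0 // => m _;
       rewrite big_ord0 mulr0.
  (* With an empty tail the difference is [harm m.+1 - harm m = x m], so [k] is raised with
     coefficient [1] instead of [1 - t]: this is the Kronecker delta. *)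
  rewrite (@eq_wsum _ c (fun m => zfactor k m * (_ - _))
                    (fun m => zfactor k.+1 m * 1)) //; first by ring.
  move=> m m_gt0; under eq_bigr do rewrite mulr1.
  rewrite harm_rev // subn0 harmS // /zfactor /=.
  by case: k k_gt0 => // k _; rewrite exprS /=; ring.
move=> /[dup] /andP[k'_gt0 _] ks_gt0.
rewrite split_sum_cons /= (split_entry c k (tsum t (k' :: ks))) //.
rewrite (eq_wsum R (f := fun m => zfactor k m * split_sum t (k' :: ks) m)
  (g := fun m => zfactor k m * hoffman_rhs t (k' :: ks) m
   + zfactor k m * boundary t (fun r => zfactor k' r * tsum t ks r) m) a_gt0);
  last by move=> m m_gt0; rewrite IHks // mulrDr.
rewrite -wsumD hoffman_rhs_cons // wsum_raise_lower //.
set g := tsum t (k' :: ks); set G := fun r => zfactor k' r * tsum t ks r.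
(* [boundary_harm] leaves [(1 - t) * x m] times the strict sum [g m - t * G m]. The part with [g]
   raises [k], and [1 - t] joins the diagonal [t * (k - 1)] to form [1 + (k - 2) * t]; the part with
   [G] yields the merges with [t * (t - 1)]. *)
have key : wsum R c (fun m => zfactor k m *
      (harm m.+1 * g m - \sum_(1 <= n < m) x (m - n) * g n)) a
    + wsum R c (fun m => zfactor k m * boundary t G m) a
  = (1 - t) * wsum R c (fun m => zfactor k.+1 m * g m) a
    + t * (t - 1) *
      wsum R c (fun m => zfactor k m * (x m * zfactor k' m * tsum t ks m)) a.
  rewrite !wsumZ !wsumD; apply: eq_wsum => // m m_gt0.
  rewrite -mulrDr boundary_harm // {1}/zfactor /=.
  have -> : \sum_(1 <= r < m) G r = g m - t * G m by rewrite /g /= addrK.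
  case: k k_gt0 => // k _; rewrite /G /zfactor exprS /=; ring.
rewrite [tsum c _ a]/= [tsum c [:: k, k' & ks] a]/= -/g.
rewrite -/G (canRL (addrK _) key); ring.
Qed.

End InterpolatedSums.

(** * The ring of formal power series *)

Section FpsRing.
Variable R : comNzRingType.
Implicit Types f g : fps R.

HB.instance Definition _ := gen_eqMixin (fps R).
HB.instance Definition _ := gen_choiceMixin (fps R).

Fact fps_addA : associative (@fps_add R).
Proof. by move=> f g k; apply/funext => n; apply: addrA. Qed.
Fact fps_addC : commutative (@fps_add R).
Proof. by move=> f g; apply/funext => n; apply: addrC. Qed.
Fact fps_add0 : left_id (fun=> 0) (@fps_add R).
Proof. by move=> f; apply/funext => n; apply: add0r. Qed.
Fact fps_addN : left_inverse (fun=> 0) (@fps_opp R) (@fps_add R).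
Proof. by move=> f; apply/funext => n; apply: addNr. Qed.

HB.instance Definition _ :=
  GRing.isZmodule.Build (fps R) fps_addA fps_addC fps_add0 fps_addN.

Lemma fps_mul_coefl f g g' n :
  (forall i, (i <= n)%N -> g i = g' i) -> fps_mul f g n = fps_mul f g' n.
Proof. by move=> eq_g; apply: eq_bigr => i _; rewrite eq_g ?leq_subr. Qed.

(** Coefficient [n] depends only on truncations, so ring laws can be taken from polynomials. *)
Lemma fps_mul_poly f g n :
  fps_mul f g n = ((\poly_(i < n.+1) f i) * (\poly_(i < n.+1) g i))`_n.
Proof.
rewrite coefM; apply: eq_bigr => i _.
by rewrite !coef_poly ltn_ord ltnS leq_subr.
Qed.

Fact fps_mulC : commutative (@fps_mul R).
Proof. by move=> f g; apply/funext => n; rewrite !fps_mul_poly mulrC. Qed.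

Fact fps_mulDl : left_distributive (@fps_mul R) (@fps_add R).
Proof.
move=> f g k; apply/funext => n; rewrite /fps_mul /fps_add -big_split /=.
by apply: eq_bigr => i _; rewrite mulrDl.
Qed.

Fact fps_mul1 : left_id (@fps1 R) (@fps_mul R).
Proof.
move=> f; apply/funext => n; rewrite /fps_mul big_ord_recl /= mul1r subn0.
by rewrite big1 ?addr0 // => i _; rewrite mul0r.
Qed.

Fact fps_mulA : associative (@fps_mul R).
Proof.
have coef_trunc (p : {poly R}) f n :
    (p * \poly_(i < n.+1) f i)`_n = \sum_(i < n.+1) p`_i * f (n - i)%N.
  rewrite coefM; apply: eq_bigr => i _.
  by rewrite coef_poly ltnS leq_subr.
have mul_trunc f g n i : (i <= n)%N ->
    fps_mul f g i = ((\poly_(i < n.+1) f i) * (\poly_(i < n.+1) g i))`_i.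
  move=> le_in; rewrite coefM; apply: eq_bigr => j _.
  rewrite !coef_poly !ltnS (leq_trans _ le_in) ?leq_ord //.
  by rewrite (leq_trans (leq_subr _ _)).
have assoc f g k n : fps_mul (fps_mul f g) k n =
    ((\poly_(i < n.+1) f i) * (\poly_(i < n.+1) g i)
      * (\poly_(i < n.+1) k i))`_n.
  rewrite coef_trunc; apply: eq_bigr => i _.
  by rewrite (mul_trunc _ _ n) // leq_ord.
move=> f g k; apply/funext => n.
(* Commuting the left side first brings both products into the bracketing of [assoc]. *)
by rewrite fps_mulC !assoc mulrC mulrA mulrAC.
Qed.

Fact fps1_neq0 : fps1 R != 0.
Proof.
apply/eqP => /(congr1 (fun f : fps R => f 0%N)) /eqP.
by rewrite /fps1 /= oner_eq0.
Qed.

HB.instance Definition _ := GRing.Zmodule_isComNzRing.Build (fps R)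
  fps_mulA fps_mulC fps_mul1 fps_mulDl fps1_neq0.

Lemma coef_fps_sum I (r : seq I) (P : pred I) (F : I -> fps R) n :
  (\sum_(i <- r | P i) F i) n = \sum_(i <- r | P i) F i n.
Proof. exact: (big_morph (fun f : fps R => f n)). Qed.

Lemma fps_powE f k : fps_pow f k = f ^+ k.
Proof. by elim: k => // k IHk; rewrite exprS -IHk. Qed.

Definition fps_const (c : R) : fps R := fun n => if n == 0%N then c else 0.

Lemma fps_constM c f : fps_const c * f = fps_scale c f.
Proof.
apply/funext => n; rewrite [LHS]/(fps_mul _ _ n) /fps_mul big_ord_recl subn0.
by rewrite big1 ?addr0 // => i _; rewrite mul0r.
Qed.

Fact fps_const_zmod_morphism : zmod_morphism fps_const.
Proof.
move=> c d; apply/funext => n.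
rewrite -[RHS]/(fps_const c n - fps_const d n) /fps_const.
by case: n => [|n] //=; rewrite subr0.
Qed.

Fact fps_const_monoid_morphism : monoid_morphism fps_const.
Proof.
split; first by apply/funext => -[].
move=> c d; rewrite fps_constM; apply/funext => -[|n] //.
by rewrite /fps_scale /= mulr0.
Qed.

HB.instance Definition _ :=
  GRing.isZmodMorphism.Build R (fps R) fps_const fps_const_zmod_morphism.
HB.instance Definition _ :=
  GRing.isMonoidMorphism.Build R (fps R) fps_const fps_const_monoid_morphism.

(** * Order of vanishing and inversion of series *)

Definition ord_ge d f := forall i, (i < d)%N -> f i = 0.

Lemma ord_geW d e f : (e <= d)%N -> ord_ge d f -> ord_ge e f.
Proof. by move=> le_ed f_d i lt_ie; apply: f_d; apply: leq_trans le_ed. Qed.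

Lemma ord_geM d e f g : ord_ge d f -> ord_ge e g -> ord_ge (d + e) (f * g).
Proof.
move=> f_d g_e n lt_n; rewrite [LHS]big1 // => i _.
have [/f_d -> | le_di] := ltnP i d; first by rewrite mul0r.
by rewrite g_e ?mulr0 //; have := ltn_ord i; lia.
Qed.

Lemma ord_geMr d f g : ord_ge d f -> ord_ge d (f * g).
Proof. by move=> f_d; rewrite -[d]addn0; apply: ord_geM. Qed.

Lemma ord_ge_sum d I (r : seq I) (P : pred I) (F : I -> fps R) :
  (forall i, P i -> ord_ge d (F i)) -> ord_ge d (\sum_(i <- r | P i) F i).
Proof. by move=> F_d n lt_n; rewrite coef_fps_sum big1 // => i /F_d ->. Qed.

Lemma ord_ge_exp d f n : ord_ge d f -> ord_ge (d * n) (f ^+ n).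
Proof.
move=> f_d; elim: n => [|n IHn]; first by rewrite muln0.
by rewrite exprS mulnS; apply: ord_geM.
Qed.

Lemma fps_invP f : f 0%N = 1 -> f * fps_inv f = 1.
Proof.
move=> f0; set g : fps R := 1 - f.
have g1 : ord_ge 1 g by case=> // _; rewrite (_ : g 0%N = 1 - f 0%N) // f0 subrr.
apply/funext => n.
have gX i j : (i < j)%N -> (g ^+ j) i = 0.
  by move=> lt_ij; apply: (ord_ge_exp 1) => //; rewrite mul1n.
(* [fps_inv] stops coefficient [i] at [j <= i]. Since [(g ^+ j) i] vanishes for larger [j], the
   common bound [n] serves all [i <= n] and leaves a finite geometric sum. *)
have -> : (f * fps_inv f) n = (f * \sum_(j < n.+1) g ^+ j) n.
  apply: fps_mul_coefl => i le_in; rewrite coef_fps_sum /fps_inv.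
  under eq_bigr => j _ do rewrite fps_powE.
  rewrite -!(big_mkord xpredT (fun j => (g ^+ j) i)).
  rewrite [RHS](@big_cat_nat _ _ _ i.+1) //=.
  by rewrite [X in _ = _ + X]big_nat_cond [X in _ = _ + X]big1 ?addr0 // => j /andP[/andP[? _] _];
     rewrite gX.
have -> : f = 1 - g by rewrite /g opprB addrC subrK.
rewrite -[X in X * _]opprB mulNr -subrX1 opprB.
rewrite -[LHS]/((1 : fps R) n - (g ^+ n.+1) n) gX // subr0.
by [].
Qed.

(** * q-integers and the relations between $q^m/[m]$ and $1/[m]$ *)

Definition qvar : fps R := fpsX R.

Lemma coef_qvarM f n : (qvar * f) n = if n is m.+1 then f m else 0.
Proof.
rewrite [LHS]/(fps_mul _ _ n) /fps_mul big_ord_recl mul0r add0r.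
case: n => [|n]; first by rewrite big_ord0.
rewrite big_ord_recl /= mul1r subSS subn0 big1 ?addr0 // => i _.
by rewrite mul0r.
Qed.

Lemma ord_ge_qvarX m : ord_ge m (qvar ^+ m).
Proof. by have := ord_ge_exp 1 qvar m; rewrite mul1n; apply => -[]. Qed.

Lemma qintS m : qint R m.+1 = 1 + qvar * qint R m :> fps R.
Proof.
apply/funext => n; rewrite -[RHS]/((1 : fps R) n + (qvar * qint R m) n).
by rewrite coef_qvarM; case: n => [|n]; rewrite ?addr0 ?add0r.
Qed.

Lemma qint0 : qint R 0 = 0 :> fps R.
Proof. by apply/funext. Qed.

Lemma qintD m n : qint R (m + n) = qint R m + qvar ^+ m * qint R n :> fps R.
Proof.
elim: m => [|m IHm]; first by rewrite qint0 add0r mul1r.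
by rewrite addSn !qintS IHm exprS; ring.
Qed.

Lemma one_minus_qE : one_minus_q R = 1 - qvar :> fps R.
Proof. by []. Qed.

Lemma qint_one_minus_q m : qint R m * one_minus_q R = 1 - qvar ^+ m :> fps R.
Proof.
rewrite one_minus_qE; elim: m => [|m IHm]; first by rewrite qint0 mul0r subrr.
by rewrite qintS mulrDl -mulrA IHm exprS; ring.
Qed.

Definition qrecip m : fps R := fps_inv (qint R m).

Lemma qrecipP m : (0 < m)%N -> qint R m * qrecip m = 1.
Proof. by move=> m_gt0; apply: fps_invP; rewrite /qint m_gt0. Qed.

Definition qfrac m : fps R := qvar ^+ m * qrecip m.

(** This is $(1-q)[m]=1-q^m$ divided by $[m]$. *)
Lemma qrecipE m : (0 < m)%N -> qrecip m = qfrac m + one_minus_q R.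
Proof.
move=> m_gt0; rewrite -[one_minus_q R : fps R]mul1r -(qrecipP m m_gt0).
by rewrite mulrAC qint_one_minus_q /qfrac; ring.
Qed.

(** This is $[n]=[m]-q^n[m-n]$ multiplied by $q^{m-n}/([m][n][m-n])$. *)
Lemma qrecip_qfrac m n : (0 < n < m)%N ->
  qrecip m * qfrac (m - n) = qrecip n * (qfrac (m - n) - qfrac m).
Proof.
move=> /andP[n_gt0 lt_nm]; have m_gt0 : (0 < m)%N by apply: ltn_trans lt_nm.
set d := (m - n)%N; have d_gt0 : (0 < d)%N by rewrite subn_gt0.
have def_m : m = (n + d)%N by rewrite subnKC // ltnW.
rewrite -[LHS]mulr1 -(qrecipP n n_gt0).
have -> : qint R n = qint R m - qvar ^+ n * qint R d :> fps R.
  by rewrite def_m qintD addrK.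
have -> : qrecip m * qfrac d * ((qint R m - qvar ^+ n * qint R d) * qrecip n) =
   qrecip n * (qfrac d * (qint R m * qrecip m)
      - qvar ^+ n * qvar ^+ d * qrecip m * (qint R d * qrecip d)).
  by rewrite /qfrac; ring.
by rewrite !qrecipP // !mulr1 -exprD -def_m.
Qed.

Lemma ztermE k m : (0 < k)%N ->
  zterm R k m = zfactor (fps R) qfrac qrecip k m.
Proof.
case: k => // k _; rewrite /zterm !fps_powE /zfactor /qfrac subn1 /=.
by rewrite exprMn -exprM mulnC exprS -mulrA [X in _ = _ * X]mulrC.
Qed.

Lemma zsum_cons k ks M :
  zsum R (k :: ks) M = \sum_(1 <= m < M) zterm R k m * zsum R ks m :> fps R.
Proof. by apply/funext => n; rewrite coef_fps_sum. Qed.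

Lemma ord_ge_zterm k m : (2 <= k)%N -> ord_ge m (zterm R k m).
Proof.
move=> k_ge2; apply: ord_geMr; rewrite fps_powE.
by apply: ord_geW (ord_ge_qvarX _); apply: leq_pmull; lia.
Qed.

(** A leading entry of at least 2 makes every summand with [m > n] divisible by $q^{n+1}$. *)
Lemma zsum_stable ks M N n : (2 <= head 0 ks)%N -> (n < M)%N -> (n < N)%N ->
  zsum R ks M n = zsum R ks N n.
Proof.
case: ks => // k ks k_ge2.
suff stab P : (n < P)%N -> zsum R (k :: ks) P n = zsum R (k :: ks) n.+1 n.
  by move=> /stab -> /stab ->.
move=> lt_nP; rewrite !zsum_cons !coef_fps_sum (@big_cat_nat _ _ _ n.+1) //=.
rewrite [X in _ + X]big_nat_cond [X in _ + X]big1 ?addr0 //.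
move=> m /andP[/andP[lt_nm _] _].
exact: (ord_geMr _ _ _ (ord_ge_zterm k m k_ge2)).
Qed.

End FpsRing.

(** Together with [sumn_build], this ensures that the subtractions in the exponents of $t$ and $1-q$
    are not truncated. *)
Lemma size_build k ks ops : (size (build k ks ops) <= (size ks).+1)%N.
Proof.
elim: ks k ops => [|k' ks IHks] k [|o ops] //=.
by case: ifP => _; [apply: IHks | case: ifP => _; apply: leqW].
Qed.

Lemma sumn_build k ks ops : (sumn (build k ks ops) <= k + sumn ks)%N.
Proof.
elim: ks k ops => [|k' ks IHks] k [|o ops] //=; rewrite ?addn0 ?leq_addr //.
case: ifP => _ /=; first by rewrite leq_add2l IHks.
by case: ifP => _; apply: leq_trans (IHks _ _) _; lia.
Qed.

(** As the added entries are positive, even $-1+$ does not lower the leading entry, so convergence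
    survives every filling. *)
Lemma head_build k ks ops : all (leq 1) ks -> (k <= head 0 (build k ks ops))%N.
Proof.
elim: ks k ops => [|k' ks IHks] k [|o ops] //= /andP[k'_gt0 ks_gt0].
case: ifP => _ //=.
by case: ifP => _; apply: leq_trans (IHks _ _ ks_gt0); lia.
Qed.

(** * Expansion of the box fillings *)

Section Expansion.
Variable t : {poly rat}.
Let F : comNzRingType := fps {poly rat}.
Let T : F := fps_const _ t.
Let h : F := one_minus_q {poly rat}.
Let x : nat -> F := qfrac {poly rat}.
Let y : nat -> F := qrecip {poly rat}.
Let y_x m : (0 < m)%N -> y m = x m + h := @qrecipE {poly rat} m.

Lemma tsum0_cons k ks M : tsum F T x y 0 (k :: ks) M =
  \sum_(1 <= m < M) zfactor F x y k m * tsum F T x y T ks m.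
Proof. by rewrite /= /wsum mul0r addr0. Qed.

(** Induction on the tail. A comma gives $m_1>m_2$; the two other fillings together give $m_1=m_2$
    with weight [T], because $z_{k+k'}+(1-q)z_{k+k'-1}=z_kz_{k'}$. *)
Lemma sum_allops k ks M : (0 < k)%N -> all (leq 1) ks ->
  \sum_(o <- allops (size ks))
    T ^+ ((size ks).+1 - size (build k ks o)) *
    (h ^+ (k + sumn ks - sumn (build k ks o)) *
      (zsum {poly rat} (build k ks o) M : F))
  = tsum F T x y 0 (k :: ks) M.
Proof.
elim: ks k M => [|k' ks IHks] k M k_gt0.
  move=> _; rewrite /= big_seq1 /wsum /= subnn addn0 subnn !mul1r mul0r addr0.
  by rewrite -[LHS]/(zsum _ [:: k] M) zsum_cons; apply: eq_bigr => m _;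
     rewrite ztermE.
move=> /andP[k'_gt0 ks_gt0].
rewrite [allops _]/= !big_cat !big_map big_nil /= addr0.
set S0 := \sum_(s <- _) _; set S1 := \sum_(s <- _) _; set S2 := \sum_(s <- _) _.
have -> : S0 = \sum_(1 <= m < M) zfactor F x y k m * tsum F T x y 0 (k' :: ks) m.
  under [RHS]eq_bigr => m _ do rewrite -IHks // mulr_sumr.
  rewrite exchange_big /=; apply: eq_bigr => s _.
  rewrite subSS subnDl -!/(zsum _ (k :: build k' ks s) M) zsum_cons !mulr_sumr.
  by apply: eq_bigr => m _; rewrite -ztermE //; ring.
have -> : S1 = T * tsum F T x y 0 ((k + k')%N :: ks) M.
  rewrite -IHks ?addn_gt0 ?k_gt0 // mulr_sumr; apply: eq_bigr => s _.
  by rewrite subSn ?size_build // exprS -!mulrA addnA.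
have -> : S2 = T * h * tsum F T x y 0 ((k + k' - 1)%N :: ks) M.
  rewrite -IHks; [|lia|done]; rewrite mulr_sumr; apply: eq_bigr => s _.
  rewrite subSn ?size_build // exprS.
  have le_b := sumn_build (k + k' - 1) ks s.
  (* The filling $-1+$ loses one unit of weight, which accounts for the extra factor [h]. *)
  have -> : (k + (k' + sumn ks) - sumn (build (k + k' - 1) ks s))%N =
     (k + k' - 1 + sumn ks - sumn (build (k + k' - 1) ks s)).+1 by lia.
  by rewrite exprS; ring.
rewrite !tsum0_cons !mulr_sumr -!big_split /=.
rewrite [RHS]/wsum mul0r addr0; apply: eq_big_nat => m /andP[m_gt0 _].
rewrite /wsum mul0r addr0.
have -> : zfactor F x y (k + k') m = zfactor F x y k m * zfactor F x y k' m
   - h * zfactor F x y (k + k' - 1) m.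
  case: k k' k_gt0 k'_gt0 {S0 S1 S2} => [|k] [|k'] // _ _.
  rewrite /zfactor addSn addnS subn1 /= exprS exprD y_x //; ring.
ring.
Qed.

End Expansion.

(** * Comparison of coefficients and the theorem *)

Lemma zeta_qtE ks n M : all (leq 1) ks -> (2 <= head 0 ks)%N -> (n < M)%N ->
  zeta_qt ks n = tsum (fps {poly rat}) (fps_const _ 'X)
    (qfrac {poly rat}) (qrecip {poly rat}) 0 ks M n.
Proof.
case: ks => // k ks ks_gt0 k_ge2 lt_nM; have /andP[k_gt0 ks'_gt0] := ks_gt0.
rewrite -sum_allops // coef_fps_sum; apply: eq_bigr => o _.
rewrite -rmorphXn fps_constM -fps_powE /fps_scale; congr (_ * _).
apply: fps_mul_coefl => i le_in; apply: zsum_stable; last exact: leq_ltn_trans lt_nM.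
  exact: leq_trans (head_build _ _ _ ks'_gt0).
by [].
Qed.

(** The factor [harm (M - m) - harm M] is minus the sum of [qfrac R s] over [M - m <= s < M], so its
    order is at least [M - m]; [G m] supplies the other [m]. *)
Lemma ord_ge_boundary (R : comNzRingType) (G : nat -> fps R) M :
  (forall m, ord_ge R m (G m)) -> ord_ge R M (boundary _ (qfrac R) 0 G M).
Proof.
move=> G_ge; rewrite /boundary [X in _ - X]mul0r subr0 big_nat_cond; apply: ord_ge_sum => m.
rewrite andbT => /andP[m_gt0 lt_mM]; rewrite !mul0r addr0 subr0.
rewrite -[X in ord_ge _ X](subnKC (ltnW lt_mM)); apply: ord_geM => //.
have -> : harm _ (qfrac R) M = harm _ (qfrac R) (M - m)
   + \sum_(M - m <= s < M) qfrac R s.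
  by rewrite /harm -big_cat_nat ?leq_subr // subn_gt0.
rewrite opprD addNKr -sumrN big_nat_cond; apply: ord_ge_sum => s.
rewrite andbT => /andP[le_s _]; rewrite -mulrN.
by apply: ord_geMr; apply: ord_geW le_s (ord_ge_qvarX _ _).
Qed.

Theorem theorem4p1 (ks : seq nat) :
  all (fun k => 0 < k)%N ks -> (2 <= head 0 ks)%N ->
  (fun n => \sum_(i < size ks) \sum_(j < (nth 0 ks i).-1)
      zeta_qt (take i ks ++ [:: (nth 0 ks i - j)%N; j.+1] ++ drop i.+1 ks) n)
  =
  fps_add
    (fps_add
      (fun n => \sum_(i < size ks)
         (1 + ((nth 0 ks i)%:R - 2 + (i == (size ks).-1 :> nat)%:R) * 'X)
           * zeta_qt (take i ks ++ (nth 0 ks i).+1 :: drop i.+1 ks) n)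
      (fun n => ('X * ('X - 1)) * \sum_(i < (size ks).-1)
         zeta_qt (take i ks ++ (nth 0 ks i + nth 0 ks i.+1).+1 :: drop i.+2 ks) n))
    (fps_mul (one_minus_q _)
      (fun n => \sum_(i < size ks) ('X * ((nth 0 ks i)%:R - 1)) * zeta_qt ks n
         + ('X * ('X - 1)) * \sum_(i < (size ks).-1)
             zeta_qt (take i ks ++ (nth 0 ks i + nth 0 ks i.+1) :: drop i.+2 ks) n)).
Proof.
move=> ks_gt0 k_ge2; apply/funext => n.
pose F := fps {poly rat}.
pose T : F := fps_const _ 'X.
pose Z := tsum F T (qfrac {poly rat}) (qrecip {poly rat}) 0.
have ks_pos i : (i < size ks)%N -> (0 < nth 0 ks i)%N.
  by move=> lt_i; apply: (all_nthP 0%N ks_gt0).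
(* The leading entry stays at least 2: for [i = 0] it comes from [s], otherwise from [ks]. *)
have splice i d s : all (leq 1) s -> (2 <= head 0 s)%N || (0 < i)%N -> s != [::] ->
    all (leq 1) (take i ks ++ s ++ drop d ks)
    /\ (2 <= head 0 (take i ks ++ s ++ drop d ks))%N.
  move=> s_gt0 s_ge2 s_n0; split.
    rewrite !all_cat s_gt0 /=; apply/andP.
    by split; apply/allP => k; [move/mem_take|move/mem_drop]; apply: (allP ks_gt0).
  case: i s_ge2 => [|i]; first by rewrite take0 orbF; case: s s_gt0 s_n0.
  by case: (ks) k_ge2.
(* All [m <= n] are covered because the Cauchy product with $1-q$ reads lower coefficients. *)
have zetaE i d s m : all (leq 1) s -> (2 <= head 0 s)%N || (0 < i)%N ->
    s != [::] -> (m <= n)%N ->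
    zeta_qt (take i ks ++ s ++ drop d ks) m
    = Z (take i ks ++ s ++ drop d ks) n.+1 m.
  move=> s_gt0 s_ge2 s_n0 le_mn.
  by have [? ?] := splice i d s s_gt0 s_ge2 s_n0; apply: zeta_qtE.
have k0_ge2 : (2 <= nth 0 ks 0)%N by rewrite nth0.
have mergeE d m : (m <= n)%N -> \sum_(i < (size ks).-1)
   zeta_qt (take i ks ++ (d + (nth 0 ks i + nth 0 ks i.+1))%N :: drop i.+2 ks) m
   = merge_sum F T (qfrac _) (qrecip _) d 0 ks n.+1 m.
  move=> le_mn; rewrite /merge_sum coef_fps_sum; apply: eq_bigr => i _.
  have lt_i := ltn_ord i.
  apply: (zetaE _ _ [:: _]) => //=; have := ks_pos i; have := ks_pos i.+1; lia.
have raiseE : \sum_(i < size ks)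
    (1 + ((nth 0%N ks i)%:R - 2 + (i == (size ks).-1 :> nat)%:R) * 'X)
     * zeta_qt (take i ks ++ (nth 0%N ks i).+1 :: drop i.+1 ks) n
  = raise_sum F T (qfrac _) (qrecip _) 0 ks n.+1 n.
  rewrite /raise_sum coef_fps_sum; apply: eq_bigr => i _.
  set c := 1 + _.
  have -> : 1 + ((nth 0%N ks i)%:R - 2 + (i == (size ks).-1 :> nat)%:R) * T
     = fps_const _ c.
    by rewrite /c rmorphD rmorphM !rmorphD rmorphN !rmorph_nat rmorph1.
  rewrite fps_constM; congr (_ * _).
  have lt_i := ltn_ord i.
  apply: (zetaE _ _ [:: _]) => //=; have := ks_pos i; lia.
have splitE : \sum_(i < size ks) \sum_(j < (nth 0%N ks i).-1)
     zeta_qt (take i ks ++ [:: (nth 0 ks i - j)%N; j.+1] ++ drop i.+1 ks) n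
  = split_sum F T (qfrac _) (qrecip _) 0 ks n.+1 n.
  rewrite /split_sum coef_fps_sum; apply: eq_bigr => i _.
  rewrite coef_fps_sum; apply: eq_bigr => j _.
  have lt_i := ltn_ord i; have lt_j := ltn_ord j.
  by apply: zetaE => //=; have := ks_pos i; lia.
rewrite splitE (split_sumE F (one_minus_q _) T (qfrac _) (qrecip _)
  (qrecipE _) (qrecip_qfrac _)) //; last by case: (ks) k_ge2.
set bd := boundary _ _ _ _ _.
(* With the bound [n.+1] the boundary has order at least [n.+1], just beyond coefficient [n]. *)
have bd0 : bd n = 0.
  apply: (ord_ge_boundary _ _ n.+1) => // m.
  apply: ord_geMr.
  rewrite -ztermE; [exact: ord_ge_zterm | exact: ltnW].
have TE : T * (T - 1) = fps_const _ ('X * ('X - 1)).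
  by rewrite rmorphM rmorphB rmorph1.
rewrite /hoffman_rhs TE !fps_constM.
rewrite -[LHS]/(_ n + fps_scale _ _ n + (_ * _ : F) n + bd n) bd0 addr0.
congr (_ + _ + _).
- by rewrite raiseE.
- by rewrite /fps_scale -mergeE.
apply: fps_mul_coefl => m le_mn.
rewrite -[LHS]/((_ * _ : F) m + fps_scale _ _ m); congr (_ + _); last first.
  by rewrite /fps_scale -mergeE.
rewrite mulr_suml coef_fps_sum; apply: eq_bigr => i _.
have -> : T * ((nth 0%N ks i)%:R - 1) = fps_const _ ('X * ((nth 0%N ks i)%:R - 1)).
  by rewrite rmorphM rmorphB rmorph1 rmorph_nat.
rewrite fps_constM /fps_scale -zeta_qtE //.
Qed.
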